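(* Let $P$ be an abelian group, let $h\colon P\to\mathbb R$ and $s\in\mathbb R_{>0}$, and assume that for all $L_0,\dots,L_r\in P$ and $m=(m_1,\dots,m_r)\in\mathbb Z^r$ we have, as $|m|\to\infty$, $$h(m_1L_1+\dots+m_rL_r)=O(|m|^s)\quad\text{and}\quad h(L_0+m_1L_1+\dots+m_rL_r)-h(m_1L_1+\dots+m_rL_r)=O(|m|^{s-1}),$$ where $|m|=\sum_i|m_i|$ and the implied constants may depend on $L_0,\dots,L_r$. Then there is a unique function $\hat h\colon P_{\mathbb R}\to\mathbb R$ such that: (i) for every $L\in P$, $\hat h(L)=\limsup_{m\to+\infty}m^{-s}h(mL)$; (ii) $\hat h(tM)=t^s\hat h(M)$ for all $t\in\mathbb R_{\ge0}$ and $M\in P_{\mathbb R}$; (iii) $\hat h$ is continuous on every finite-dimensional real subspace of $P_{\mathbb R}$.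
   Context: $P_{\mathbb R}=P\otimes_{\mathbb Z}\mathbb R$, and the image of $L\in P$ in $P_{\mathbb R}$ is still denoted $L$. *)

(* Defs.v *)
From HB Require Import structures.
From mathcomp Require Import all_boot all_order all_algebra.
From mathcomp Require Import all_classical all_reals all_analysis.
Set Implicit Arguments. Unset Strict Implicit. Unset Printing Implicit Defensive.
Import Order.TTheory GRing.Theory Num.Theory.
Import numFieldNormedType.Exports.
Local Open Scope ring_scope.

Definition normZ (r : nat) (m : 'I_r -> int) : nat := (\sum_(i < r) `|m i|)%N.

Definition bigO_inf (R : realType) (r : nat) (F : ('I_r -> int) -> R) (e : R)
  : Prop :=
  exists C : R, exists N : nat, forall m : 'I_r -> int,
    (N <= normZ m)%N -> `|F m| <= C * ((normZ m)%:R `^ e).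

Definition height_growth (R : realType) (P : zmodType) (h : P -> R) (s : R)
  : Prop :=
  forall (r : nat) (L0 : P) (L : 'I_r -> P),
    bigO_inf (fun m => h (\sum_(i < r) L i *~ m i)) s /\
    bigO_inf (fun m => h (L0 + \sum_(i < r) L i *~ m i)
                       - h (\sum_(i < r) L i *~ m i)) (s - 1).

(* (V, iota) is P (x)_Z R: universal among additive maps from P to real
   vector spaces *)
Definition is_realification (R : realType) (P : zmodType) (V : lmodType R)
  (iota : {additive P -> V}) : Prop :=
  forall (W : lmodType R) (f : {additive P -> W}),
    (exists g : {linear V -> W}, forall x, g (iota x) = f x) /\
    (forall g1 g2 : {linear V -> W},
        (forall x, g1 (iota x) = g2 (iota x)) -> forall v, g1 v = g2 v).

(* continuity on every finite-dimensional real subspace: for every finite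
   family v_1..v_n, t |-> f (sum t_i v_i) is continuous on R^n *)
Definition cont_fin_dim (R : realType) (V : lmodType R) (f : V -> R) : Prop :=
  forall (n : nat) (v : 'I_n -> V),
    continuous (fun t : 'rV[R]_n => f (\sum_(i < n) t ord0 i *: v i)).

(* Main.v *)
Require Import Defs.
From HB Require Import structures.
From mathcomp Require Import all_boot all_order all_algebra.
From mathcomp Require Import all_classical all_reals all_analysis.
From mathcomp Require Import ring_quotient generic_quotient.
From mathcomp Require Import ring lra zify.
Set Implicit Arguments. Unset Strict Implicit. Unset Printing Implicit Defensive.
Import Order.TTheory GRing.Theory Num.Theory.
Import numFieldNormedType.Exports.
Local Open Scope ring_scope.

(* For a finitely supported c : P -> R put
     H(c) = limsup_m m^(-s) h(sum_y floor(m c(y)) y).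
   The growth hypotheses, summed along lattice paths that avoid the origin,
   show that moving the integral coefficients by at most d m changes h by at
   most e m^s. Hence H is continuous on finite-dimensional spaces, homogeneous
   of degree s (compare the indices m and floor(m t)), and unchanged when a real
   multiple of delta_(x+y) - delta_x - delta_y is added to c. By homogeneity the
   periods of H form a subspace of the space of functions P -> R, so H descends
   to the quotient by it, through which P (x) R maps by its universal property.
   Uniqueness holds because (i) and (ii) determine the function on positive
   rational multiples of the image of P, which are dense in the
   finite-dimensional subspaces spanned by elements of P. *)

(** * Quotient modules and the span of P *)

Section LmodQuotient.
Variables (R : nzRingType) (V : lmodType R) (K : V -> Prop).
Hypotheses (K0 : K 0) (KD : forall x y, K x -> K y -> K (x + y)).
Hypothesis KZ : forall a x, K x -> K (a *: x).

Definition submod_pred : {pred V} := fun x => `[< K x >].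

Lemma submod_pred_zmod_closed : zmod_closed submod_pred.
Proof.
split; first exact/asboolP.
move=> x y /asboolP Kx /asboolP Ky; apply/asboolP/KD => //.
by rewrite -scaleN1r; apply: KZ.
Qed.

HB.instance Definition _ :=
  GRing.isZmodClosed.Build V submod_pred submod_pred_zmod_closed.

Definition lmod_quot : Type := Quotient.quot submod_pred.
HB.instance Definition _ := GRing.Zmodule.on lmod_quot.

Definition lmod_quot_pi (x : V) : lmod_quot :=
  (\pi_(Quotient.quot submod_pred) x)%qT.

Lemma lmod_quot_pi_eq x y : lmod_quot_pi x = lmod_quot_pi y <-> K (x - y).
Proof.
have E := Quotient.idealrBE submod_pred x y.
split=> [/eqP xy|Kxy].
  by apply/asboolP; change (x - y \in submod_pred); rewrite E.
by apply/eqP; rewrite /lmod_quot_pi -E; apply/asboolP.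
Qed.

Lemma lmod_quot_piD x y :
  lmod_quot_pi (x + y) = lmod_quot_pi x + lmod_quot_pi y.
Proof. exact: raddfD. Qed.

Lemma lmod_quot_pi_surj (w : lmod_quot) : lmod_quot_pi (repr w) = w.
Proof. exact: reprK. Qed.

(** Defined through a chosen representative; stability of [K] under scaling makes the class
    independent of that choice. *)
Definition lmod_quot_scale (a : R) (w : lmod_quot) : lmod_quot :=
  lmod_quot_pi (a *: repr w).

Lemma lmod_quot_piZ a x :
  lmod_quot_scale a (lmod_quot_pi x) = lmod_quot_pi (a *: x).
Proof.
apply/lmod_quot_pi_eq; rewrite -scalerBr; apply: KZ.
by apply/lmod_quot_pi_eq; rewrite lmod_quot_pi_surj.
Qed.

Lemma lmod_quot_scaleA a b w :
  lmod_quot_scale a (lmod_quot_scale b w) = lmod_quot_scale (a * b) w.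
Proof. by rewrite -(lmod_quot_pi_surj w) !lmod_quot_piZ scalerA. Qed.

Lemma lmod_quot_scale1 : left_id 1 lmod_quot_scale.
Proof. by move=> w; rewrite -(lmod_quot_pi_surj w) lmod_quot_piZ scale1r. Qed.

Lemma lmod_quot_scaleDr : right_distributive lmod_quot_scale +%R.
Proof.
move=> a w z; rewrite -(lmod_quot_pi_surj w) -(lmod_quot_pi_surj z).
by rewrite -lmod_quot_piD !lmod_quot_piZ -lmod_quot_piD scalerDr.
Qed.

Lemma lmod_quot_scaleDl w :
  {morph lmod_quot_scale^~ w : a b / a + b}.
Proof.
move=> a b /=; rewrite -(lmod_quot_pi_surj w).
by rewrite !lmod_quot_piZ -lmod_quot_piD scalerDl.
Qed.

HB.instance Definition _ := GRing.Zmodule_isLmodule.Build R lmod_quot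
  lmod_quot_scaleA lmod_quot_scale1 lmod_quot_scaleDr lmod_quot_scaleDl.

Lemma lmod_quot_pi_linear : linear lmod_quot_pi.
Proof. by move=> a x y; rewrite lmod_quot_piD -lmod_quot_piZ. Qed.

HB.instance Definition _ :=
  GRing.isLinear.Build R V lmod_quot _ lmod_quot_pi lmod_quot_pi_linear.

Lemma lmod_quotient_exists : exists (W : lmodType R) (p : {linear V -> W}),
  (forall w, exists v, p v = w) /\ (forall x y, p x = p y <-> K (x - y)).
Proof.
exists lmod_quot, lmod_quot_pi; split=> [w|x y]; last exact: lmod_quot_pi_eq.
by exists (repr w); apply: lmod_quot_pi_surj.
Qed.
End LmodQuotient.

Section Span.
Variables (R : realType) (P : zmodType) (V : lmodType R).
Variable iota : {additive P -> V}.

Definition span_pred : {pred V} := fun v =>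
  `[< exists l : seq (R * P), v = \sum_(x <- l) x.1 *: iota x.2 >].

Lemma span_pred_submod_closed : submod_closed span_pred.
Proof.
split; first by apply/asboolP; exists [::]; rewrite big_nil.
move=> a u v /asboolP[l ->] /asboolP[l' ->]; apply/asboolP.
exists ([seq (a * x.1, x.2) | x <- l] ++ l').
rewrite big_cat big_map /= scaler_sumr; congr (_ + _).
by apply: eq_bigr => x _; rewrite scalerA.
Qed.

HB.instance Definition _ :=
  GRing.isSubmodClosed.Build R V span_pred span_pred_submod_closed.

Lemma span_pred_iota x : iota x \in span_pred.
Proof. by apply/asboolP; exists [:: (1, x)]; rewrite big_seq1 scale1r. Qed.

Record spanT := SpanT { span_val :> V; _ : span_val \in span_pred }.
HB.instance Definition _ := [isSub for span_val].
HB.instance Definition _ := [Choice of spanT by <:].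
HB.instance Definition _ := [SubChoice_isSubLmodule of spanT by <:].

Definition span_iota (x : P) : spanT := SpanT (span_pred_iota x).

Lemma span_iota_zmod_morphism : zmod_morphism span_iota.
Proof. by move=> x y; apply: val_inj; rewrite /= raddfB. Qed.

HB.instance Definition _ :=
  GRing.isZmodMorphism.Build P spanT span_iota span_iota_zmod_morphism.

(* Compare the identity of V with the composite of the inclusion of the span
   and the map into the span given by the universal property. *)
Lemma realification_span (hV : is_realification iota) (v : V) :
  exists l : seq (R * P), v = \sum_(x <- l) x.1 *: iota x.2.
Proof.
have [[g gE] _] := hV _ span_iota.
have [_ U] := hV _ iota.
have lin_j : linear (fun w : V => val (g w)).
  by move=> a x y; rewrite linearP.
pose jM := GRing.isLinear.Build R V V _ _ lin_j.
pose j : {linear V -> V} := HB.pack (fun w : V => val (g w)) jM.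
have := U j idfun; rewrite /= => /(_ _ v) <-; last by move=> x; rewrite gE.
exact/asboolP/(valP (g v)).
Qed.
End Span.

(** * Uniform continuity of h at large scale *)

(** Later estimates produce both [d] and its [s]-th power, and either can be the larger one
    depending on whether s < 1. With u = min(1, e/(A+1)), the choice d = min(u, u^(1/s)) makes both
    at most u. *)
Lemma small_powR (R : realType) (s A e : R) : 0 < s -> 0 <= A -> 0 < e ->
  exists d : R, [/\ 0 < d, d <= 1, A * d `^ s <= e & A * d <= e].
Proof.
move=> s0 A0 e0; have A1 : 0 < A + 1 by lra.
have q0 : 0 < e / (A + 1) by exact: divr_gt0.
pose u := Num.min 1 (e / (A + 1)).
have u0 : 0 < u by rewrite /u lt_min ltr01.
have u1 : u <= 1 by rewrite /u ge_min lexx.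
have uq : A * u <= e.
  have h1 : u <= e / (A + 1) by rewrite /u ge_min lexx orbT.
  have h2 : e / (A + 1) * (A + 1) = e by rewrite mulfVK// gt_eqF.
  nra.
pose d := Num.min u (u `^ s^-1).
have w0 : 0 < u `^ s^-1 by exact: powR_gt0.
have d0 : 0 < d by rewrite /d lt_min u0.
have du : d <= u by rewrite /d ge_min lexx.
exists d; split=> //; first exact: le_trans du u1.
  apply: le_trans uq; apply: ler_wpM2l => //.
  have -> : u = (u `^ s^-1) `^ s by rewrite -powRrM mulVf ?gt_eqF// powRr1// ltW.
  apply: ge0_ler_powR; rewrite ?nnegrE ?(ltW s0) ?(ltW d0) ?(ltW w0)//.
  by rewrite /d ge_min lexx orbT.
by apply: le_trans uq; apply: ler_wpM2l.
Qed.

(** A power function is monotone on the positive axis, so its maximum on an interval is at an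
    endpoint; adding both endpoint values avoids fixing the sign of the exponent [p]. *)
Lemma powR_le_endpoints (R : realType) (p u x w : R) : 0 < u -> u <= x -> x <= w ->
  x `^ p <= u `^ p + w `^ p.
Proof.
move=> u0 ux xw; have x0 : 0 < x by exact: lt_le_trans u0 ux.
have w0 : 0 < w by exact: lt_le_trans x0 xw.
have mono (q a b : R) : 0 <= q -> 0 < a -> a <= b -> a `^ q <= b `^ q.
  move=> q0 a0 ab; apply: ge0_ler_powR => //; rewrite nnegrE ltW//.
  exact: lt_le_trans a0 ab.
have [p0|/ltW p0] := leP 0 p.
  by rewrite (le_trans (mono _ _ _ p0 x0 xw))// lerDr powR_ge0.
apply: (@le_trans _ _ (u `^ p)); last by rewrite lerDl powR_ge0.
have -> : p = - (- p) by rewrite opprK.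
rewrite !(powRN _ (- p)) lef_pV2 ?posrE ?powR_gt0//.
by apply: mono => //; rewrite oppr_ge0.
Qed.

Definition zdist (r : nat) (a b : 'I_r -> int) : nat := normZ (fun i => a i - b i).

Lemma normZ_le_zdist (r : nat) (a b : 'I_r -> int) : (normZ a <= normZ b + zdist a b)%N.
Proof. by rewrite -big_split /=; apply: leq_sum => i _; lia. Qed.

Lemma zdistC (r : nat) (a b : 'I_r -> int) : zdist a b = zdist b a.
Proof. by apply: eq_bigr => i _; lia. Qed.

Definition zcomb (P : zmodType) (r : nat) (L : 'I_r -> P) (a : 'I_r -> int) : P :=
  \sum_(i < r) L i *~ a i.

Lemma zcomb_step (P : zmodType) (r : nat) (L : 'I_r -> P) (a : 'I_r -> int)
    (i : 'I_r) (e : int) :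
  zcomb L (fun j => a j + e *+ (j == i)) = L i *~ e + zcomb L a.
Proof.
rewrite /zcomb addrC.
under eq_bigr do rewrite mulrzDr.
rewrite big_split /=; congr (_ + _).
rewrite (bigD1 i) //= eqxx big1 ?addr0 // => j /negPf ->.
by rewrite mulr0z.
Qed.

Lemma closer_point (r n : nat) (a b : 'I_r -> int) : zdist b a = n.+1 ->
  exists (i : 'I_r) (e : bool),
    zdist (fun j => b j + (-1) ^+ e *+ (j == i)) a = n.
Proof.
move=> ban; have [i bai] : exists i, b i != a i.
  apply/existsP; rewrite -[X in is_true X]negbK negb_exists; apply/negP => /forallP ba.
  suff : zdist b a = 0%N by rewrite ban.
  rewrite /zdist /normZ big1// => i _; move: (ba i).
  by rewrite negbK => /eqP ->; rewrite subrr.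
(* The boolean is the exponent of -1: the [i]-th coordinate goes down exactly when it exceeds that
   of [a]. *)
exists i, (a i < b i); move: ban; rewrite /zdist /normZ.
rewrite (bigD1 i) //= [in X in _ -> X](bigD1 i) //= eqxx.
under [in X in _ -> X]eq_bigr => j /negPf ji do rewrite ji addr0.
by case: ltP => ab /=; lia.
Qed.

(** Induction on the distance to [a], telescoping over unit steps. Steps are controlled only at
    points strictly closer to [a] than [N], which keeps the path inside a ball. *)
Lemma path_bound (R : realType) (r : nat) (F : ('I_r -> int) -> R) (E : R) (N : nat)
    (a : 'I_r -> int) :
  (forall c i (e : bool), (zdist c a < N)%N ->
     `|F (fun j => c j + (-1) ^+ e *+ (j == i)) - F c| <= E) ->
  forall b, (zdist b a <= N)%N -> `|F b - F a| <= (zdist b a)%:R * E.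
Proof.
move=> step b; have [n ban] : exists n, zdist b a = n by exists (zdist b a).
rewrite ban; elim: n b ban => [|n IH] b ban nN.
  suff -> : b = a by rewrite subrr normr0 mul0r.
  apply/funext => i; move: ban => /eqP; rewrite /zdist /normZ sum_nat_eq0.
  by move=> /forallP/(_ i)/=; lia.
have [i [e bn]] := closer_point ban.
set b' := (fun j => _) in bn.
(* The step is reversed so that the hypothesis is applied at the inner point [b']. *)
have bE : b = fun j => b' j + (-1) ^+ (~~ e) *+ (j == i).
  apply/funext => j; rewrite /b' -addrA -mulrnDl.
  by case: e {bn b'}; rewrite /= ?expr0 ?expr1 ?subrr ?addNr mul0rn addr0.
have h1 : `|F b' - F a| <= n%:R * E by apply: IH => //; apply: ltnW.
have h2 : `|F b - F b'| <= E by rewrite {1}bE; apply: step; rewrite bn.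
rewrite -natr1 mulrDl mul1r.
have -> : F b - F a = (F b' - F a) + (F b - F b') by ring.
by apply: le_trans (ler_normD _ _) _; apply: lerD.
Qed.

(** The ball is finite: shifting coordinates by [N] encodes its points as finite functions, and the
    sum of all absolute values over these is a bound. *)
Lemma ball_bounded (R : realType) (P : zmodType) (h : P -> R) (r : nat)
    (L : 'I_r -> P) (N : nat) :
  exists2 B : R, 0 <= B & forall a, (normZ a <= N)%N -> `|h (zcomb L a)| <= B.
Proof.
pose dec (f : {ffun 'I_r -> 'I_(N + N).+1}) (i : 'I_r) : int := (f i)%:Z - N%:Z.
exists (\sum_f `|h (zcomb L (dec f))|); first exact: sumr_ge0.
move=> a aN; pose f := [ffun i : 'I_r => inord (absz (a i + N%:Z)) : 'I_(N + N).+1].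
have fa : dec f = a.
  apply/funext => i; have aiN : (absz (a i) <= N)%N.
    by apply: leq_trans aN; rewrite /normZ (bigD1 i) //= leq_addr.
  by rewrite /dec ffunE inordK; lia.
by rewrite (bigD1 f) //= fa lerDl sumr_ge0.
Qed.

Section UniformClose.
Variables (R : realType) (P : zmodType) (h : P -> R) (s : R).
Hypothesis hgrowth : height_growth h s.

(** The additive constant [B] absorbs the finitely many points below the threshold of the
    O-bound. *)
Lemma growth_bound (r : nat) (L : 'I_r -> P) : exists (C B : R),
  [/\ 0 <= C, 0 <= B & forall a, `|h (zcomb L a)| <= C * (normZ a)%:R `^ s + B].
Proof.
have [[C [N hC]] _] := hgrowth 0 L.
have [B B0 hB] := ball_bounded h L N.
exists `|C|, B; split=> // a; have [Na|/ltnW aN] := leqP N (normZ a).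
  apply: le_trans (hC _ Na) _; rewrite -[leLHS]addr0; apply: lerD => //.
  by apply: ler_wpM2r; [exact: powR_ge0|exact: ler_norm].
by apply: le_trans (hB _ aN) _; rewrite lerDr mulr_ge0 ?powR_ge0.
Qed.

(** Apply the second growth hypothesis with [L0] each of the finitely many elements [L i] and their
    opposites; summing constants and thresholds makes them uniform. *)
Lemma step_bound (r : nat) (L : 'I_r -> P) : exists (C : R) (N : nat),
  0 <= C /\ forall a (i : 'I_r) (e : bool), (N <= normZ a)%N ->
    `|h (zcomb L (fun j => a j + (-1) ^+ e *+ (j == i))) - h (zcomb L a)|
      <= C * (normZ a)%:R `^ (s - 1).
Proof.
have /fin_all_exists2[C] : forall x : 'I_r * bool, exists2 C : R, True &
    exists N : nat, forall a, (N <= normZ a)%N ->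
    `|h (L x.1 *~ (-1) ^+ x.2 + zcomb L a) - h (zcomb L a)|
      <= C * (normZ a)%:R `^ (s - 1).
  move=> x; have [_ [C [N hN]]] := hgrowth (L x.1 *~ (-1) ^+ x.2) L.
  by exists C => //; exists N.
move=> _ /fin_all_exists[N hN].
exists (\sum_x `|C x|), (\sum_x N x)%N; split; first exact: sumr_ge0.
move=> a i e Na; rewrite zcomb_step.
have Nx : (N (i, e) <= normZ a)%N.
  by apply: leq_trans Na; rewrite (bigD1 (i, e)) //= leq_addr.
apply: le_trans (hN (i, e) a Nx) _; apply: ler_wpM2r; first exact: powR_ge0.
rewrite (bigD1 (i, e)) //=; apply: le_trans (ler_norm _) _.
by rewrite lerDl sumr_ge0.
Qed.

Hypothesis s0 : 0 < s.

(* If a is short compared with d * m the O(|m|^s) bound suffices; otherwise a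
   path of unit steps from a to b stays at distance at least d * m from the
   origin, which keeps |m|^(s - 1) under control also when s < 1. *)
Lemma height_uniform (r : nat) (L : 'I_r -> P) (K e : R) : 0 <= K -> 0 < e ->
  exists (d m0 : R), [/\ 0 < d, 0 < m0 & forall (m : R) a b, m0 <= m ->
    (normZ a)%:R <= K * m -> (zdist b a)%:R <= d * m ->
    `|h (zcomb L b) - h (zcomb L a)| <= e * m `^ s].
Proof.
move=> K0 e0; have [C1 [B [C10 B0 hC1]]] := growth_bound L.
have [C2 [N [C20 hC2]]] := step_bound L.
(* The first summand serves the case of short [a], the other two the path estimate. *)
pose A := C1 * 3 `^ s *+ 2 + C2 + C2 * (K + 1) `^ (s - 1).
have A1 : 0 <= C1 * 3 `^ s by rewrite mulr_ge0 ?powR_ge0.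
have A2 : 0 <= C2 * (K + 1) `^ (s - 1) by rewrite mulr_ge0 ?powR_ge0.
have [|d [d0 d1 Ads Ad]] := small_powR (A := A) s0 _ (divr_gt0 e0 (ltr0Sn _ 1)).
  by rewrite /A; lra.
have ds0 : 0 <= d `^ s by exact: powR_ge0.
pose q := 4 * B / e.
have q0 : 0 <= q by apply: divr_ge0; [exact: mulr_ge0|exact: ltW].
(* The second term ensures 4B <= e m^s, the third N <= d m, so that [hC2] applies to all points at
   distance at least d m from the origin. *)
exists d, (1 + q `^ s^-1 + N%:R / d); split=> //.
  have : 0 <= q `^ s^-1 by exact: powR_ge0.
  have : 0 <= N%:R / d by rewrite divr_ge0// ltW.
  by lra.
move=> m a b mm0 aK bad.
have mq : q `^ s^-1 <= m.
  have : 0 <= N%:R / d by rewrite divr_ge0// ltW.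
  by lra.
have mN : N%:R <= d * m.
  have : 0 <= q `^ s^-1 by exact: powR_ge0.
  have : N%:R / d * d = N%:R by rewrite mulfVK ?gt_eqF.
  by nra.
have m0 : 0 < m.
  have : 0 <= N%:R / d by rewrite divr_ge0// ltW.
  have : 0 <= q `^ s^-1 by exact: powR_ge0.
  by lra.
have mono (x y : R) : 0 <= x -> x <= y -> x `^ s <= y `^ s.
  move=> x0 xy; apply: ge0_ler_powR; rewrite ?nnegrE ?(ltW s0)//.
  exact: le_trans xy.
have BM : 4 * B <= e * m `^ s.
  have h1 : q <= m `^ s.
    have -> : q = (q `^ s^-1) `^ s by rewrite -powRrM mulVf ?gt_eqF// powRr1.
    by apply: mono => //; exact: powR_ge0.
  have h2 : q * e = 4 * B by rewrite /q mulfVK// gt_eqF.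
  by nra.
have ms0 : 0 <= m `^ s by exact: powR_ge0.
have dm0 : 0 < d * m by exact: mulr_gt0.
(* If |a| < 2dm then |b| < 3dm, and both heights are bounded separately. *)
have [alt|age] := ltP (normZ a)%:R (2 * (d * m)).
  have bnd c : (normZ c)%:R <= 3 * (d * m) ->
      `|h (zcomb L c)| <= C1 * 3 `^ s * (d `^ s * m `^ s) + B.
    move=> c3; apply: le_trans (hC1 c) _; rewrite lerD2r -mulrA ler_wpM2l//.
    rewrite -(powRM _ (ltW d0) (ltW m0)) -(powRM _ (ler0n _ 3) (ltW dm0)).
    exact: mono.
  have ha : `|h (zcomb L a)| <= C1 * 3 `^ s * (d `^ s * m `^ s) + B.
    by apply: bnd; lra.
  have hb : `|h (zcomb L b)| <= C1 * 3 `^ s * (d `^ s * m `^ s) + B.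
    apply: bnd; have := normZ_le_zdist b a.
    by rewrite -(ler_nat R) natrD; lra.
  apply: le_trans (ler_normB _ _) _.
  have : C1 * 3 `^ s *+ 2 * d `^ s <= e / 2.
    apply: le_trans Ads; apply: ler_wpM2r => //.
    by rewrite /A -addrA lerDl addr_ge0.
  by nra.
(* Now |a| >= 2dm and the path stays within dm of [a], so its points have norm between dm and
   (K+1)m; [E] bounds each unit step. *)
set E := C2 * ((d * m) `^ (s - 1) + ((K + 1) * m) `^ (s - 1)).
have hp : `|h (zcomb L b) - h (zcomb L a)| <= (zdist b a)%:R * E.
  apply: (@path_bound _ _ (fun c => h (zcomb L c)) E (zdist b a)) => // c i e' ca.
  have c1 := normZ_le_zdist a c; have c2 := normZ_le_zdist c a.
  rewrite zdistC in c1.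
  have {}c1 : d * m <= (normZ c)%:R.
    by move: c1 ca; rewrite -(ler_nat R) natrD -(ltr_nat R); lra.
  have {}c2 : (normZ c)%:R <= (K + 1) * m.
    move: c2 ca; rewrite -(ler_nat R) natrD -(ltr_nat R) mulrDl mul1r.
    have : d * m <= m by nra.
    by lra.
  apply: le_trans (hC2 c i e' _) _.
    by rewrite -(ler_nat R); apply: le_trans c1.
  by rewrite ler_wpM2l// powR_le_endpoints.
apply: le_trans hp _.
have E0 : 0 <= E by rewrite mulr_ge0// addr_ge0 ?powR_ge0.
apply: le_trans (ler_wpM2r E0 bad) _.
have pw (x : R) : 0 < x -> x * x `^ (s - 1) = x `^ s.
  by move=> x0; rewrite mulr_powRB1 ?ltW.
have -> : d * m * E = (C2 * d `^ s + C2 * (K + 1) `^ (s - 1) * d) * m `^ s.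
  rewrite /E powRM; [|lra|lra]; rewrite powRM; [|lra|lra].
  by rewrite -(pw d)// -(pw m)//; ring.
apply: ler_wpM2r => //.
have : C2 * d `^ s <= e / 2.
  by apply: le_trans Ads; apply: ler_wpM2r => //; rewrite /A; lra.
have : C2 * (K + 1) `^ (s - 1) * d <= e / 2.
  by apply: le_trans Ad; apply: ler_wpM2r; rewrite ?(ltW d0)// /A; lra.
by lra.
Qed.

End UniformClose.

(** * The limit superior along integral approximations *)

Section RealLimsup.
Variable R : realType.
Implicit Types (u : nat -> R) (x : R).

Definition ev_bounded u :=
  exists (C : R) (N : nat), forall m, (N <= m)%N -> `|u m| <= C.

(** [fine] sends infinite values to 0, so this is the true limsup only when that is finite, which
    [ev_bounded] guarantees. *)
Definition rlimsup u : R := fine (limn_esup (fun m => (u m)%:E)).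

Lemma limn_esup_le u x : (exists N : nat, forall m, (N <= m)%N -> u m <= x) ->
  (limn_esup (fun m => (u m)%:E) <= x%:E)%E.
Proof.
move=> [N uN]; rewrite /limn_esup limf_esupE.
apply: ge_ereal_inf.
exists (ereal_sup ((fun m => (u m)%:E) @` [set m | (N <= m)%N]%classic)).
  by exists [set m | (N <= m)%N]%classic => //; exists N.
by apply: ge_ereal_sup => _ [m /= Nm <-]; rewrite lee_fin; apply: uN.
Qed.

Lemma limn_esup_lt u x : (limn_esup (fun m => (u m)%:E) < x%:E)%E ->
  exists N : nat, forall m, (N <= m)%N -> u m < x.
Proof.
rewrite /limn_esup limf_esupE => /ereal_inf_lt[_ [V [N _ NV] <-] Vx].
exists N => m Nm; rewrite -lte_fin; apply: le_lt_trans Vx.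
by apply: ereal_sup_ubound; exists m => //; apply: NV.
Qed.

Lemma rlimsupE u : ev_bounded u ->
  (rlimsup u)%:E = limn_esup (fun m => (u m)%:E).
Proof.
move=> [C [N uC]]; apply: fineK; rewrite fin_numElt; apply/andP; split.
  apply: (@lt_le_trans _ _ (- C)%:E); first exact: ltNyr.
  rewrite leNgt; apply/negP => /limn_esup_lt[N' uN'].
  have := uN' _ (leq_maxr N N'); have := uC _ (leq_maxl N N').
  by rewrite ler_norml => /andP[+ _]; move=> /le_lt_trans h/h; rewrite ltxx.
apply: (@le_lt_trans _ _ C%:E); last exact: ltry.
apply: limn_esup_le; exists N => m /uC; exact/le_trans/ler_norm.
Qed.

Lemma rlimsup_le u x : ev_bounded u ->
  (exists N : nat, forall m, (N <= m)%N -> u m <= x) -> rlimsup u <= x.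
Proof. by move=> bu /limn_esup_le; rewrite -rlimsupE// lee_fin. Qed.

Lemma rlimsup_lt u x : ev_bounded u -> rlimsup u < x ->
  exists N : nat, forall m, (N <= m)%N -> u m < x.
Proof. by move=> bu ux; apply: limn_esup_lt; rewrite -rlimsupE// lte_fin. Qed.

End RealLimsup.

Lemma floor_dist (R : realType) (x : R) : `|(Num.floor x)%:~R - x| <= 1.
Proof.
have := floor_itv x; rewrite ler_norml intrD => /andP[].
by lra.
Qed.

Lemma natr_large (R : realType) (x : R) :
  exists N : nat, forall m, (N <= m)%N -> x <= m%:R.
Proof.
exists (Num.truncn `|x|).+1 => m Nm; apply: le_trans (ler_norm x) _.
apply: le_trans (ltW (truncnS_gt `|x|)) _.
by rewrite ler_nat.
Qed.

Section Homogenization.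
Variables (R : realType) (P : zmodType) (h : P -> R) (s : R).
Hypotheses (s0 : 0 < s) (hgrowth : height_growth h s).
Implicit Types (D : seq P) (c : P -> R) (a b : P -> int).

(** The list [D] is a parameter rather than the support of [a], so that several functions can be
    compared over one common list. *)
Definition fcomb D a : P := \sum_(y <- D) y *~ a y.

Definition fnorm D c : R := \sum_(y <- D) `|c y|.

Definition scaled_height D c (m : nat) : R :=
  (m%:R `^ s)^-1 * h (fcomb D (fun y => Num.floor (m%:R * c y))).

Lemma fcombE D a :
  fcomb D a = zcomb (fun i : 'I_(size D) => D`_i) (fun i => a D`_i).
Proof. by rewrite /fcomb (big_nth 0) big_mkord. Qed.

Lemma fnormE D a : fnorm D (fun y => (a y)%:~R) =
  (normZ (fun i : 'I_(size D) => a D`_i))%:R.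
Proof.
rewrite /fnorm (big_nth 0) big_mkord natr_sum; apply: eq_bigr => i _.
by rewrite natr_absz intr_norm.
Qed.

Lemma fnorm_ge0 D c : 0 <= fnorm D c.
Proof. exact: sumr_ge0. Qed.

Lemma fnormD D c1 c2 : fnorm D (fun y => c1 y + c2 y) <= fnorm D c1 + fnorm D c2.
Proof. by rewrite -big_split /=; apply: ler_sum => y _; apply: ler_normD. Qed.

Lemma fnormZ D t c : fnorm D (fun y => t * c y) = `|t| * fnorm D c.
Proof. by rewrite mulr_sumr; apply: eq_bigr => y _; rewrite normrM. Qed.

Lemma fnorm_le D c1 c2 B : (forall y, `|c1 y| <= `|c2 y| + B) ->
  fnorm D c1 <= fnorm D c2 + (size D)%:R * B.
Proof.
move=> cB; have -> : (size D)%:R * B = \sum_(y <- D) B.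
  by rewrite big_const_seq count_predT iter_addr_0 mulr_natl.
by rewrite -big_split /=; apply: ler_sum.
Qed.

Lemma fcomb_uniform D (K e : R) : 0 <= K -> 0 < e ->
  exists (d m0 : R), [/\ 0 < d, 0 < m0 & forall (m : R) a b, m0 <= m ->
    fnorm D (fun y => (a y)%:~R) <= K * m ->
    fnorm D (fun y => (b y)%:~R - (a y)%:~R) <= d * m ->
    `|h (fcomb D b) - h (fcomb D a)| <= e * m `^ s].
Proof.
move=> K0 e0.
have [d [m0 [d0 m00 H]]] := height_uniform hgrowth s0 (fun i : 'I_(size D) => D`_i) K0 e0.
exists d, m0; split=> // m a b mm0 aK; rewrite fnormE in aK.
have -> : fnorm D (fun y => (b y)%:~R - (a y)%:~R) =
    fnorm D (fun y => (b y - a y)%:~R).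
  by apply: eq_bigr => y _; rewrite intrB.
by rewrite (fnormE D (fun y => b y - a y)) !fcombE => bd; apply: H.
Qed.

Lemma fcomb_near D (K B e : R) : 0 <= K -> 0 < e ->
  exists m0 : R, 0 < m0 /\ forall (m : R) a b, m0 <= m ->
    fnorm D (fun y => (a y)%:~R) <= K * m ->
    fnorm D (fun y => (b y)%:~R - (a y)%:~R) <= B ->
    `|h (fcomb D b) - h (fcomb D a)| <= e * m `^ s.
Proof.
move=> K0 e0; have [d [m0 [d0 m00 H]]] := fcomb_uniform D K0 e0.
(* Beyond this threshold the constant displacement [B] is at most d m. *)
exists (m0 + `|B| / d); split.
  by rewrite ltr_wpDr// divr_ge0// ltW.
move=> m a b mm0 aK abB; have Bd : 0 <= `|B| / d by rewrite divr_ge0// ltW.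
apply: H => //; first by lra.
apply: le_trans abB _; apply: le_trans (ler_norm _) _.
have : `|B| / d * d = `|B| by rewrite mulfVK ?gt_eqF.
by nra.
Qed.

Lemma fnorm_floor D c (m : R) : 0 <= m ->
  fnorm D (fun y => (Num.floor (m * c y))%:~R) <= m * fnorm D c + (size D)%:R.
Proof.
move=> m0; rewrite -[X in X * _](ger0_norm m0) -fnormZ -[X in _ + X]mulr1.
apply: fnorm_le => y; have := floor_dist (m * c y).
set u := _%:~R; set v := m * _ => uv.
have -> : u = v + (u - v) by rewrite addrC subrK.
by apply: le_trans (ler_normD _ _) _; rewrite lerD2l.
Qed.

(** For m >= 1 the rounded vector has norm at most K m, so the growth bound is O(m^s). *)
Lemma scaled_height_bounded D c : ev_bounded (scaled_height D c).
Proof.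
have [C [B [C0 B0 H]]] := growth_bound hgrowth (fun i : 'I_(size D) => D`_i).
pose K := fnorm D c + (size D)%:R.
have K0 : 0 <= K by rewrite addr_ge0 ?fnorm_ge0.
exists (C * K `^ s + B), 1%N => m m1; rewrite /scaled_height.
have m1' : 1 <= m%:R :> R by rewrite ler1n.
have ms : 1 <= m%:R `^ s.
  have {1}<- : 1 `^ s = 1 :> R by rewrite powR1.
  by apply: ge0_ler_powR; rewrite ?nnegrE ?(ltW s0).
rewrite normrM ger0_norm ?invr_ge0 ?powR_ge0//.
rewrite mulrC ler_pdivrMr; last by lra.
rewrite fcombE; apply: le_trans (H _) _.
rewrite -(fnormE D (fun y => Num.floor (m%:R * c y))) mulrDl.
apply: lerD; last by nra.
rewrite -mulrA ler_wpM2l// -powRM//.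
apply: ge0_ler_powR; rewrite ?nnegrE ?(ltW s0) ?fnorm_ge0 ?mulr_ge0//.
apply: le_trans (fnorm_floor _ _ (ler0n _ _)) _.
rewrite /K mulrC mulrDl lerD2l.
have : 0 <= (size D)%:R :> R by [].
by nra.
Qed.

Lemma scaled_height_le D c x m : (0 < m)%N -> (scaled_height D c m <= x) =
  (h (fcomb D (fun y => Num.floor (m%:R * c y))) <= x * m%:R `^ s).
Proof.
move=> m0; rewrite /scaled_height mulrC ler_pdivrMr//.
by rewrite powR_gt0// ltr0n.
Qed.

Lemma scaled_height_lt D c x m : (0 < m)%N -> (scaled_height D c m < x) =
  (h (fcomb D (fun y => Num.floor (m%:R * c y))) < x * m%:R `^ s).
Proof.
move=> m0; rewrite /scaled_height mulrC ltr_pdivrMr//.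
by rewrite powR_gt0// ltr0n.
Qed.

Definition height_limsup D c : R := rlimsup (scaled_height D c).

(** At level [m] the two roundings differ by at most m |c' - c| + 2 |D|, so [fcomb_uniform] compares
    the sequences termwise. The one-sided form suffices, since the roles of [c] and [c'] can be
    exchanged. *)
Lemma height_limsup_continuous D (K e : R) : 0 <= K -> 0 < e ->
  exists2 d : R, 0 < d & forall c c', fnorm D c <= K ->
    fnorm D (fun y => c' y - c y) <= d -> height_limsup D c' <= height_limsup D c + e.
Proof.
move=> K0 e0; have K1 : 0 <= K + (size D)%:R by rewrite addr_ge0.
have [d [m0 [d0 m00 H]]] := fcomb_uniform D K1 (divr_gt0 e0 (ltr0Sn _ 1)).
(* Half of d m is reserved for the rounding error 2 |D|, whence the term 4 |D| / d in the threshold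
   below. *)
exists (d / 2); first by rewrite divr_gt0.
move=> c c' cK cc'; apply: rlimsup_le; first exact: scaled_height_bounded.
have [N hN] : exists N : nat, forall m, (N <= m)%N ->
    scaled_height D c m < height_limsup D c + e / 2.
  by apply: rlimsup_lt; [exact: scaled_height_bounded|rewrite ltrDl divr_gt0].
have [N' hN'] := natr_large (m0 + (size D)%:R * 4 / d).
exists (N + N'.+1)%N => m Nm.
have m1 : (0 < m)%N by lia.
have m1' : 1 <= m%:R :> R by rewrite ler1n.
have {}hN : scaled_height D c m < height_limsup D c + e / 2 by apply: hN; lia.
have {}hN' : m0 + (size D)%:R * 4 / d <= m%:R by apply: hN'; lia.
have q0 : 0 <= (size D)%:R * 4 / d by rewrite divr_ge0 ?mulr_ge0// ltW.
have qd : (size D)%:R * 4 / d * d = (size D)%:R * 4 by rewrite mulfVK ?gt_eqF.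
rewrite scaled_height_le//; rewrite scaled_height_lt// in hN.
set p' := fcomb _ _; set p := fcomb _ _ in hN.
have : `|h p' - h p| <= e / 2 * m%:R `^ s.
  apply: H; first by lra.
    apply: le_trans (fnorm_floor _ _ (ler0n _ _)) _.
    have : 0 <= (size D)%:R :> R by [].
    by nra.
  apply: (@le_trans _ _ (fnorm D (fun y => m%:R * (c' y - c y)) + (size D)%:R * 2)).
    apply: fnorm_le => y; have := floor_dist (m%:R * c' y); have := floor_dist (m%:R * c y).
    set u := _%:~R; set u' := _%:~R => uv uv'.
    have -> : u' - u = m%:R * (c' y - c y) + ((u' - m%:R * c' y) - (u - m%:R * c y)) by ring.
    apply: le_trans (ler_normD _ _) _; rewrite lerD2l.
    by apply: le_trans (ler_normB _ _) _; lra.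
  rewrite fnormZ ger0_norm//.
  by nra.
rewrite ler_norml => /andP[_].
by lra.
Qed.

(* Adding a real multiple of an integral relation moves the integral
   approximations by bounded vectors only. *)
Lemma height_limsup_relation_le D c c' (t : R) (z : P -> int) : fcomb D z = 0 ->
  (forall y, c' y = c y + t * (z y)%:~R) -> height_limsup D c' <= height_limsup D c.
Proof.
move=> z0 c'E; apply/ler_addgt0Pr => e e0.
pose zn := fnorm D (fun y => (z y)%:~R).
have zn0 : 0 <= zn by exact: fnorm_ge0.
pose K := fnorm D c + (size D)%:R + (`|t| + 1) * zn.
have K0 : 0 <= K.
  by rewrite !addr_ge0 ?fnorm_ge0// mulr_ge0// addr_ge0.
have [m0 [m00 H]] := fcomb_near D (zn + (size D)%:R * 2) K0 (divr_gt0 e0 (ltr0Sn _ 1)).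
apply: rlimsup_le; first exact: scaled_height_bounded.
have [N hN] : exists N : nat, forall m, (N <= m)%N ->
    scaled_height D c m < height_limsup D c + e / 2.
  by apply: rlimsup_lt; [exact: scaled_height_bounded|rewrite ltrDl divr_gt0].
have [N' hN'] := natr_large m0.
exists (N + N'.+1)%N => m Nm.
have m1 : (0 < m)%N by lia.
have m1' : 1 <= m%:R :> R by rewrite ler1n.
have {}hN : scaled_height D c m < height_limsup D c + e / 2 by apply: hN; lia.
have {}hN' : m0 <= m%:R by apply: hN'; lia.
rewrite scaled_height_le//; rewrite scaled_height_lt// in hN.
(* Adding an integral multiple of the relation leaves the element of [P] unchanged and lands at
   bounded distance from the rounding of m c'. *)
pose a y := Num.floor (m%:R * c y) + Num.floor (m%:R * t) * z y.
have aE : fcomb D a = fcomb D (fun y => Num.floor (m%:R * c y)).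
  rewrite /fcomb; under eq_bigr do rewrite mulrzDr [X in _ + _ *~ X]mulrC mulrzA.
  by rewrite big_split /= -mulrz_suml -/(fcomb D z) z0 mul0rz addr0.
have ft := floor_dist (m%:R * t).
rewrite -aE in hN; set p' := fcomb _ _.
have : `|h p' - h (fcomb D a)| <= e / 2 * m%:R `^ s.
  apply: H => //.
    apply: (@le_trans _ _ (fnorm D (fun y => (Num.floor (m%:R * c y))%:~R) +
      fnorm D (fun y => (Num.floor (m%:R * t))%:~R * (z y)%:~R))).
      rewrite -big_split /=; apply: ler_sum => y _.
      by rewrite /a intrD intrM; apply: ler_normD.
    rewrite fnormZ -/zn.
    have := fnorm_floor D c (ler0n _ m).
    have : `|(Num.floor (m%:R * t))%:~R : R| <= (`|t| + 1) * m%:R.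
      have -> : (Num.floor (m%:R * t))%:~R = m%:R * t +
          ((Num.floor (m%:R * t))%:~R - m%:R * t) by rewrite addrC subrK.
      apply: le_trans (ler_normD _ _) _; rewrite normrM ger0_norm//.
      by rewrite mulrC mulrDl mul1r; lra.
    have : 0 <= (size D)%:R :> R by [].
    rewrite /K; set S := (size D)%:R; set T := `|_%:~R|; set W := `|t| + 1.
    set X := fnorm D (fun y => (Num.floor _)%:~R).
    by nra.
  apply: fnorm_le => y; rewrite c'E /a intrD intrM.
  have f1 := floor_dist (m%:R * (c y + t * (z y)%:~R)).
  have f2 := floor_dist (m%:R * c y).
  set u1 := _%:~R in f1 *; set u2 := _%:~R in f2 *; set u3 := _%:~R in ft *.
  have -> : u1 - (u2 + u3 * (z y)%:~R) = - ((u3 - m%:R * t) * (z y)%:~R) +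
     ((u1 - m%:R * (c y + t * (z y)%:~R)) - (u2 - m%:R * c y)) by ring.
  apply: le_trans (ler_normD _ _) _; rewrite normrN normrM; apply: lerD.
    by rewrite -[leRHS]mul1r ler_wpM2r.
  by apply: le_trans (ler_normB _ _) _; lra.
rewrite ler_norml => /andP[_].
by lra.
Qed.

Lemma height_limsup_relation D c c' (t : R) (z : P -> int) : fcomb D z = 0 ->
  (forall y, c' y = c y + t * (z y)%:~R) -> height_limsup D c' = height_limsup D c.
Proof.
move=> z0 c'E; apply/eqP; rewrite eq_le (height_limsup_relation_le z0 c'E) /=.
apply: (height_limsup_relation_le (t := - t) z0) => y.
by rewrite c'E mulNr addrK.
Qed.

End Homogenization.

(** * Homogeneity and periods *)

Lemma powR_continuous_eps (R : realType) (s t e : R) : 0 < t -> 0 < e ->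
  exists2 d : R, 0 < d & forall y, `|y - t| < d -> `|y `^ s - t `^ s| < e.
Proof.
move=> t0 e0; have ct : {for t, continuous (fun x : R => x `^ s)}.
  apply: differentiable_continuous; apply/derivable1_diffP.
  by apply: derivable_powR; rewrite in_itv /= t0.
have /cvgrPdist_lt/(_ _ e0)/nbhs_ballP[d /= d0 hd] := ct.
exists d => // y yt; rewrite distrC; apply: hd.
by rewrite /ball /= distrC.
Qed.

(** Both sums reduce to the common entries of [D] and [D'], which agree up to permutation. *)
Lemma eq_sum_supports (P : zmodType) (F : P -> P) (D D' : seq P) : uniq D -> uniq D' ->
  (forall y, y \notin D -> F y = 0) -> (forall y, y \notin D' -> F y = 0) ->
  \sum_(y <- D) F y = \sum_(y <- D') F y.
Proof.
have restr (E E' : seq P) : (forall y, y \notin E' -> F y = 0) ->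
    \sum_(y <- E) F y = \sum_(y <- [seq y <- E | y \in E']) F y.
  move=> E'0; rewrite big_filter [RHS]big_mkcond /=.
  by apply: eq_bigr => y _; case: ifPn => // /E'0.
move=> uD uD' D0 D'0; rewrite (restr D D' D'0) (restr D' D D0).
apply: perm_big; apply: uniq_perm; rewrite ?filter_uniq// => y.
by rewrite !mem_filter andbC.
Qed.

Section HomogenizationFree.
Variables (R : realType) (P : zmodType) (h : P -> R) (s : R).
Hypotheses (s0 : 0 < s) (hgrowth : height_growth h s).
Implicit Types (D : seq P) (c k : P -> R^o).

Local Notation height_limsup := (height_limsup h s).
Local Notation scaled_height := (scaled_height h s).

(* The subsequence of indices n = floor(m t) only gives an inequality; the
   opposite one is the same inequality for 1/t. *)
Lemma height_limsup_scale_le D c c' (t : R) : 0 < t -> (forall y, c' y = t * c y) ->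
  height_limsup D c' <= t `^ s * height_limsup D c.
Proof.
move=> t0 c'E.
(* Three errors occur: one [e] from approaching the limsup of [c], one from comparing heights, one
   from replacing (n/m)^s by t^s. *)
suff H e : 0 < e -> height_limsup D c' <= t `^ s * (height_limsup D c + e) + e *+ 2.
  apply/ler_addgt0Pr => e e0.
  have ts0 : 0 <= t `^ s by exact: powR_ge0.
  have q0 : 0 < e / (t `^ s + 2) by apply: divr_gt0 => //; lra.
  have := H _ q0; have : e / (t `^ s + 2) * (t `^ s + 2) = e.
    by rewrite mulfVK// gt_eqF//; lra.
  by nra.
move=> e0; set x := height_limsup D c + e.
have [N hN] : exists N : nat, forall m, (N <= m)%N -> scaled_height D c m < x.
  by apply: rlimsup_lt; [exact: scaled_height_bounded|rewrite ltrDl].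
have x10 : 0 < `|x| + 1 by have := normr_ge0 x; lra.
have [d d0 hd] := powR_continuous_eps s t0 (divr_gt0 e0 x10).
pose K := t * fnorm D c + (size D)%:R.
have K0 : 0 <= K by rewrite addr_ge0// mulr_ge0 ?fnorm_ge0// ltW.
have [m0 [m00 H]] := fcomb_near s0 hgrowth D (fnorm D c + (size D)%:R * 2) K0 e0.
(* The three terms give m >= m0, floor(m t) > N, and 1/m < d. *)
have [N1 hN1] := natr_large (m0 + (N%:R + 2) / t + 2 / d).
apply: rlimsup_le; first exact: scaled_height_bounded.
exists N1.+1 => m Nm.
have m1 : (0 < m)%N by lia.
have m1' : 1 <= m%:R :> R by rewrite ler1n.
have {}hN1 := hN1 _ (ltnW Nm).
have q1 : (N%:R + 2) / t * t = N%:R + 2 by rewrite mulfVK ?gt_eqF.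
have q2 : 2 / d * d = 2 by rewrite mulfVK ?gt_eqF.
have q3 : 0 <= (N%:R + 2) / t by rewrite divr_ge0// ?addr_ge0// ltW.
have q4 : 0 <= 2 / d by rewrite divr_ge0// ltW.
have mt0 : 0 <= m%:R * t by rewrite mulr_ge0// ltW.
pose n := Num.truncn (m%:R * t).
have /andP[n1 n2] : n%:R <= m%:R * t < n.+1%:R by exact: truncn_itv.
rewrite -natr1 in n2.
have Nn : (N < n)%N.
  by rewrite -(ltr_nat R); nra.
have hn : scaled_height D c n < x by apply: hN; apply: ltnW.
have n0 : (0 < n)%N by exact: leq_ltn_trans Nn.
rewrite (scaled_height_le _ _ _ _ _ m1); rewrite (scaled_height_lt _ _ _ _ _ n0) in hn.
set p' := fcomb _ _; set p := fcomb _ _ in hn.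
have hp : `|h p' - h p| <= e * m%:R `^ s.
  apply: H; first by lra.
    apply: le_trans (fnorm_floor _ _ (ler0n _ _)) _.
    have : 0 <= (size D)%:R :> R by [].
    have := fnorm_ge0 D c.
    by rewrite /K; nra.
  apply: fnorm_le => y; rewrite c'E.
  have f1 := floor_dist (m%:R * (t * c y)); have f2 := floor_dist (n%:R * c y).
  set u1 := _%:~R in f1 *; set u2 := _%:~R in f2 *.
  have -> : u1 - u2 = (m%:R * t - n%:R) * c y +
     ((u1 - m%:R * (t * c y)) - (u2 - n%:R * c y)) by ring.
  apply: le_trans (ler_normD _ _) _; apply: lerD.
    rewrite normrM -[leRHS]mul1r ler_wpM2r// ler_norml; lra.
  by apply: le_trans (ler_normB _ _) _; lra.
have {}hd : `|(n%:R / m%:R) `^ s - t `^ s| < e / (`|x| + 1).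
  apply: hd; have -> : n%:R / m%:R - t = (n%:R - m%:R * t) / m%:R.
    by field; rewrite gt_eqF//; lra.
  rewrite normrM normfV [`|m%:R|]ger0_norm// ltr_pdivrMr; last by lra.
  by rewrite ltr_norml; nra.
have nmE : n%:R `^ s = (n%:R / m%:R) `^ s * m%:R `^ s.
  by rewrite -powRM ?divr_ge0// mulfVK// gt_eqF//; lra.
have ms0 : 0 < m%:R `^ s by apply: powR_gt0; lra.
(* The sign of [x] is unknown, so the error is bounded through |x|; this is why the tolerance in
   [hd] is e / (|x| + 1). *)
have xe : x * (n%:R / m%:R) `^ s <= t `^ s * x + e.
  have : x * ((n%:R / m%:R) `^ s - t `^ s) <= e.
    apply: le_trans (ler_norm _) _; rewrite normrM.
    have qe : e / (`|x| + 1) * (`|x| + 1) = e by rewrite mulfVK// gt_eqF.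
    have := normr_ge0 x; have : 0 < e / (`|x| + 1) by exact: divr_gt0.
    set w := `|_ - _| in hd *; have w0 : 0 <= w by exact: normr_ge0.
    by nra.
  by lra.
have : h p <= (t `^ s * x + e) * m%:R `^ s.
  apply: le_trans (ltW hn) _; rewrite nmE mulrA.
  by apply: ler_wpM2r => //; apply: ltW.
move: hp; rewrite ler_norml => /andP[_].
by rewrite mulr2n; lra.
Qed.

Lemma height_limsup_scale D c c' (t : R) : 0 < t -> (forall y, c' y = t * c y) ->
  height_limsup D c' = t `^ s * height_limsup D c.
Proof.
move=> t0 c'E; apply/eqP; rewrite eq_le height_limsup_scale_le//=.
have cE y : c y = t^-1 * c' y by rewrite c'E mulKf// gt_eqF.
have tV : 0 < t^-1 by rewrite invr_gt0.
have := height_limsup_scale_le D tV cE.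
have ts0 : 0 < t `^ s by exact: powR_gt0.
have E : t `^ s * t^-1 `^ s = 1.
  by rewrite -powRM ?ltW// mulfV ?gt_eqF// powR1.
by move=> /(ler_wpM2l (ltW ts0)); rewrite mulrA E mul1r.
Qed.

(** Doubling [c] changes nothing on [D] yet multiplies the value by 2^s > 1, so the value is 0. *)
Lemma height_limsup_zero D c : (forall y, y \in D -> c y = 0) -> height_limsup D c = 0.
Proof.
move=> c0; pose c' y := 2 * c y.
have cc' : height_limsup D c' = height_limsup D c.
  congr rlimsup; apply/funext => m; congr (_ * h _).
  by apply: eq_big_seq => y yD; rewrite /c' c0// mulr0.
have := height_limsup_scale D (ltr0Sn R 1) (fun y => erefl (c' y)); rewrite cc'.
have : 1 < 2 `^ s.
  have {1}<- : 1 `^ s = 1 :> R by rewrite powR1.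
  by apply: gt0_ltr_powR; rewrite ?nnegrE// ltr1n.
by nra.
Qed.

Definition finsupp c := exists2 D, uniq D & forall y, y \notin D -> c y = 0.

(** The empty list for functions of infinite support makes [free_height] vanish there; thus it is
    defined, and homogeneous, on the whole module of functions. *)
Definition supp c : seq P :=
  if pselect (finsupp c) is left H then s2val (cid2 H) else [::].

Definition free_height c : R := height_limsup (supp c) c.

(** Points outside the support have floor 0 and contribute nothing, so any duplicate-free list
    containing the support gives the same value. *)
Lemma free_heightE D c : uniq D -> (forall y, y \notin D -> c y = 0) ->
  free_height c = height_limsup D c.
Proof.
move=> uD D0; rewrite /free_height /supp; case: pselect => [H|[]]; last by exists D.
case: cid2 => E /= uE E0; congr rlimsup; apply/funext => m; congr (_ * h _).
by apply: eq_sum_supports => // y; [move=> /E0 ->|move=> /D0 ->]; rewrite mulr0 floor0 mulr0z.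
Qed.

Lemma free_height_infsupp c : ~ finsupp c -> free_height c = 0.
Proof.
by move=> nc; rewrite /free_height /supp; case: pselect => // _; apply: height_limsup_zero.
Qed.

Lemma finsuppZ (t : R) c : finsupp c -> finsupp (t *: c).
Proof.
by move=> [D uD D0]; exists D => // y /D0 cy; rewrite fctE /= cy scaler0.
Qed.

Lemma finsuppD c k : finsupp c -> finsupp k -> finsupp (c + k).
Proof.
move=> [D uD D0] [E uE E0]; exists (undup (D ++ E)); first exact: undup_uniq.
move=> y; rewrite mem_undup mem_cat negb_or => /andP[/D0 cy /E0 ky].
by rewrite fctE cy ky addr0.
Qed.

Lemma free_heightZ (t : R) c : 0 <= t -> free_height (t *: c) = t `^ s * free_height c.
Proof.
rewrite le_eqVlt => /predU1P[<-|t0].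
  rewrite powR0 ?gt_eqF// mul0r (@free_heightE [::])//; first exact: height_limsup_zero.
  by move=> y _; rewrite fctE /= scale0r.
have [[D uD D0]|nc] := pselect (finsupp c).
  rewrite (free_heightE uD D0) (@free_heightE D)//; first exact: height_limsup_scale.
  by move=> y /D0 cy; rewrite fctE /= cy scaler0.
rewrite !free_height_infsupp ?mulr0// => /(finsuppZ t^-1).
by rewrite scalerA mulVf ?gt_eqF// scale1r.
Qed.

Definition period k := forall c, free_height (c + k) = free_height c.

Lemma period0 : period 0.
Proof. by move=> c; rewrite addr0. Qed.

Lemma periodD k k' : period k -> period k' -> period (k + k').
Proof. by move=> pk pk' c; rewrite addrA pk' pk. Qed.

Lemma periodN k : period k -> period (- k).
Proof. by move=> pk c; rewrite -(pk (c - k)) subrK. Qed.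

Lemma periodZ (t : R) k : period k -> period (t *: k).
Proof.
have pos (u : R) k' : 0 < u -> period k' -> period (u *: k').
  move=> u0 pk' c; have {1}-> : c = u *: (u^-1 *: c).
    by rewrite scalerA mulfV ?gt_eqF// scale1r.
  rewrite -scalerDr free_heightZ ?ltW// pk' -free_heightZ ?ltW//.
  by rewrite scalerA mulfV ?gt_eqF// scale1r.
move=> pk; have [t0|t0|->] := ltgtP t 0; last 1 first.
- by rewrite scale0r; apply: period0.
- rewrite -[t]opprK scaleNr; apply/periodN/pos => //.
  by rewrite oppr_gt0.
- exact: pos.
Qed.

Definition fdelta (x : P) : P -> R^o := fun y => (y == x)%:R.

Lemma finsupp_fdelta x : finsupp (fdelta x).
Proof. by exists [:: x] => // y; rewrite inE /fdelta => /negPf ->. Qed.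

Lemma period_relation x y : period (fdelta (x + y) - fdelta x - fdelta y).
Proof.
set k := (_ - _).
have fk : finsupp k.
  have := finsuppD (finsuppD (finsupp_fdelta (x + y))
    (finsuppZ (-1) (finsupp_fdelta x))) (finsuppZ (-1) (finsupp_fdelta y)).
  by rewrite !scaleN1r.
move=> c; have [fc|nc] := pselect (finsupp c); last first.
  rewrite !free_height_infsupp// => /finsuppD/(_ (finsuppZ (-1) fk)).
  by rewrite scaleN1r addrK.
have [D uD D0] := finsuppD fc fk.
(* The three points are added because [D] supports only c + k, which may vanish at some of them
   although [k] and [c] do not. *)
pose E := undup (D ++ [:: x + y; x; y]).
have EP p : p \notin E -> [/\ p \notin D, p != x + y, p != x & p != y].
  by rewrite mem_undup mem_cat !inE !negb_or => /and4P[-> -> -> ->].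
have cE p : c p + k p = (c + k) p by [].
have kz p : p \notin E -> k p = 0.
  move=> /EP[_ /negPf p1 /negPf p2 /negPf p3].
  by rewrite /k !fctE /fdelta p1 p2 p3 !subr0.
have ckz p : p \notin E -> (c + k) p = 0 by move=> /EP[/D0].
have cz p : p \notin E -> c p = 0.
  by move=> pE; have := ckz _ pE; rewrite -cE kz// addr0.
have uE : uniq E by exact: undup_uniq.
rewrite (free_heightE uE ckz) (free_heightE uE cz).
pose z (p : P) : int := (p == x + y)%:R - (p == x)%:R - (p == y)%:R.
apply: (@height_limsup_relation _ _ _ _ s0 hgrowth E c _ 1 z).
  have dlt q : q \in E -> \sum_(p <- E) p *~ (p == q)%:R = q.
    move=> qE; rewrite (bigD1_seq q)//= eqxx mulr1z big1 ?addr0//.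
    by move=> p /negPf ->; rewrite mulr0z.
  rewrite /fcomb /z; under eq_bigr do rewrite !mulrzBr.
  rewrite !sumrB !dlt ?mem_undup ?mem_cat ?inE ?eqxx ?orbT//.
  by rewrite [x + y]addrC addrK subrr.
move=> p; rewrite mul1r -cE; congr (_ + _).
by rewrite /k /z !fctE /fdelta !intrB !rmorph_nat.
Qed.

End HomogenizationFree.

(** * Uniqueness and existence *)

Lemma row_ballP (R : realType) (n : nat) (t u : 'rV[R]_n) (e : R) : 0 < e ->
  ball t e u <-> forall i, `|t ord0 i - u ord0 i| < e.
Proof.
move=> e0; split=> [[_ tu] i|tu]; first exact: (tu ord0 i).
by split=> // i j; rewrite (ord1 i); exact: tu.
Qed.

Section Uniqueness.
Variables (R : realType) (P : zmodType) (V : lmodType R).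
Variables (iota : {additive P -> V}) (s : R).

Lemma homogeneous_continuous_eq (f g : V -> R) :
  (forall L, f (iota L) = g (iota L)) ->
  (forall (t : R) M, 0 <= t -> f (t *: M) = t `^ s * f M) ->
  (forall (t : R) M, 0 <= t -> g (t *: M) = t `^ s * g M) ->
  cont_fin_dim f -> cont_fin_dim g ->
  forall l : seq (R * P), f (\sum_(x <- l) x.1 *: iota x.2) =
                          g (\sum_(x <- l) x.1 *: iota x.2).
Proof.
move=> fg fZ gZ cf cg l; rewrite (big_nth (0, 0)) big_mkord.
set n := size l; pose L (i : 'I_n) := (nth (0, 0) l i).2.
pose t : 'rV[R]_n := \row_i (nth (0, 0) l i).1.
pose comb (u : 'rV[R]_n) := \sum_(i < n) u ord0 i *: iota (L i).
have -> : \sum_(i < n) (nth (0, 0) l i).1 *: iota (nth (0, 0) l i).2 = comb t.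
  by apply: eq_bigr => i _; rewrite mxE.
have cphi : {for t, continuous (fun u : 'rV[R]_n => f (comb u) - g (comb u))}.
  exact: cvgB (cf n (fun i => iota (L i)) t) (cg n (fun i => iota (L i)) t).
apply/eqP; rewrite -subr_eq0; apply: contraT => phi0.
have e0 : 0 < `|f (comb t) - g (comb t)| by rewrite normr_gt0.
have /cvgrPdist_lt/(_ _ e0)/nbhs_ballP[d /= d0 hd] := cphi.
(* Rounding with denominator k >= 2/d moves each coefficient by at most 1/k < d. *)
have [N hN] := natr_large (2 / d).
have {hN} kd : 2 / d <= N.+1%:R by exact: hN.
have k0 : 0 < N.+1%:R :> R by rewrite ltr0n.
set k : R := N.+1%:R in kd k0.
pose a i : int := Num.floor (k * t ord0 i).
pose u : 'rV[R]_n := \row_i ((a i)%:~R / k).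
have tu : ball t d u.
  apply/(row_ballP _ _ d0) => i; rewrite [u ord0 i]mxE.
  have -> : t ord0 i - (a i)%:~R / k = - (((a i)%:~R - k * t ord0 i) / k).
    by field; rewrite gt_eqF.
  rewrite normrN normrM normfV [`|k|]ger0_norm ?ltW// ltr_pdivrMr//.
  have := floor_dist (k * t ord0 i); rewrite -/(a i).
  have : 2 / d * d = 2 by rewrite mulfVK ?gt_eqF.
  by nra.
(* At [u] the combination is a positive rational multiple of an element of the image of [P], where
   [f] and [g] agree; this contradicts the strict bound. *)
have := hd _ tu; have -> : comb u = k^-1 *: iota (\sum_(i < n) L i *~ a i).
  rewrite raddf_sum scaler_sumr; apply: eq_bigr => i _.
  by rewrite [u ord0 i]mxE raddfMz -scaler_int scalerA mulrC.
by rewrite fZ ?gZ ?invr_ge0 ?ltW// fg subrr subr0 ltxx.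
Qed.

End Uniqueness.

Section Existence.
Variables (R : realType) (P : zmodType) (V : lmodType R).
Variables (iota : {additive P -> V}) (hV : is_realification iota).
Variables (h : P -> R) (s : R).
Hypotheses (s0 : 0 < s) (hgrowth : height_growth h s).

Local Notation free_height := (free_height h s).

Definition fcombR (l : seq (R * P)) : P -> R^o :=
  \sum_(x <- l) x.1 *: fdelta R x.2.

Lemma fcombR_supp l y : y \notin [seq x.2 | x <- l] -> fcombR l y = 0.
Proof.
rewrite /fcombR; elim: l => [|x l IH] /=; first by rewrite big_nil.
rewrite inE negb_or big_cons => /andP[/negPf yx /IH yl].
by rewrite fctE yl addr0 fctE /= /fdelta yx scaler0.
Qed.

(* W is the space of functions P -> R modulo the periods of free_height; by
   period_relation the map x |-> fdelta x becomes additive in W. *)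
Lemma free_height_factors : exists hh : V -> R,
  [/\ forall l, hh (\sum_(x <- l) x.1 *: iota x.2) = free_height (fcombR l)
    & forall (t : R) M, 0 <= t -> hh (t *: M) = t `^ s * hh M].
Proof.
have [W [p [psurj pE]]] := lmod_quotient_exists (@period0 _ _ h s)
  (@periodD _ _ h s) (periodZ s0 hgrowth).
pose f (x : P) : W := p (fdelta R x).
have fD x y : f (x + y) = f x + f y.
  rewrite /f -linearD; apply/pE; rewrite opprD addrA.
  exact: period_relation.
have fB : zmod_morphism f.
  by move=> x y; have := fD (x - y) y; rewrite subrK => ->; rewrite addrK.
pose fM := GRing.isZmodMorphism.Build P W f fB.
pose fA : {additive P -> W} := HB.pack f fM.
have [[g gE] _] := hV fA.
(* [sg] picks representatives; by [hE] the choice is harmless, since two of them differ by a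
   period. *)
have [sg sgK] := choice psurj.
have hE v c : p c = g v -> free_height (sg (g v)) = free_height c.
  move=> pc; have kc : period h s (sg (g v) - c) by apply/pE; rewrite sgK.
  by rewrite -(kc c) subrKC.
exists (fun v => free_height (sg (g v))); split=> [l|t M t0].
  apply: hE; rewrite !linear_sum; apply: eq_bigr => x _.
  by rewrite !linearZ gE.
by rewrite -free_heightZ//; apply: hE; rewrite !linearZ /= sgK.
Qed.

Lemma free_height_combination_continuous (n : nat) (c : 'I_n -> P -> R^o) (D : seq P) :
  uniq D -> (forall i y, y \notin D -> c i y = 0) ->
  continuous (fun t : 'rV[R]_n => free_height (\sum_(i < n) t ord0 i *: c i)).
Proof.
move=> uD D0 t.
pose ct (u : 'rV[R]_n) : P -> R^o := \sum_(i < n) u ord0 i *: c i.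
have ctE u y : ct u y = \sum_(i < n) u ord0 i * c i y.
  by rewrite /ct fct_sumE.
have GE u : free_height (ct u) = height_limsup h s D (ct u).
  apply: free_heightE => // y yD; rewrite ctE big1// => i _.
  by rewrite D0// mulr0.
apply/(@cvgrPdist_le _ _ _ (nbhs t)) => e e0.
(* The extra 1 makes [K] bound nearby [ct u] too, so the one-sided estimate applies in both
   directions. *)
pose K := fnorm D (ct t) + 1.
have K0 : 0 <= K by rewrite addr_ge0// fnorm_ge0.
have [d d0 hd] := height_limsup_continuous s0 hgrowth D K0 e0.
pose S := \sum_(i < n) fnorm D (c i).
have S0 : 0 <= S by apply: sumr_ge0 => i _; exact: fnorm_ge0.
pose r := Num.min d 1 / (S + 1).
have S1 : 0 < S + 1 by lra.
have r0 : 0 < r by apply: divr_gt0 => //; rewrite lt_min d0 ltr01.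
apply/nbhs_ballP; exists r => //= u /(row_ballP _ _ r0) tu.
have du (v w : 'rV[R]_n) : (forall i, `|v ord0 i - w ord0 i| < r) ->
    fnorm D (fun y => ct v y - ct w y) <= Num.min d 1.
  move=> vw; apply: (@le_trans _ _ (r * S)); last first.
    have : r * (S + 1) = Num.min d 1 by rewrite mulfVK// gt_eqF.
    by nra.
  rewrite /S mulr_sumr [leRHS](eq_bigr (fun i => \sum_(y <- D) r * `|c i y|)); last first.
    by move=> i _; rewrite mulr_sumr.
  rewrite exchange_big /=; apply: ler_sum => y _.
  rewrite !ctE -sumrB; apply: le_trans (ler_norm_sum _ _ _) _.
  apply: ler_sum => i _; rewrite -mulrBl normrM.
  by apply: ler_wpM2r => //; exact: ltW.
have tu' := du _ _ tu.
have ut' : fnorm D (fun y => ct u y - ct t y) <= Num.min d 1.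
  by apply: du => i; rewrite distrC.
have dd : Num.min d 1 <= d by rewrite ge_min lexx.
have d1 : Num.min d 1 <= 1 by rewrite ge_min lexx orbT.
have uK : fnorm D (ct u) <= K.
  have := fnormD D (ct t) (fun y => ct u y - ct t y).
  rewrite [X in X <= _](_ : _ = fnorm D (ct u)).
    by rewrite /K; lra.
  by apply: eq_bigr => y _; rewrite addrC subrK.
have tK : fnorm D (ct t) <= K by rewrite /K lerDl.
rewrite -/(ct t) -/(ct u) !GE ler_norml.
have := hd _ _ uK (le_trans tu' dd); have := hd _ _ tK (le_trans ut' dd).
by lra.
Qed.

Lemma homogenization_exists : exists hh : V -> R,
  [/\ forall L : P, ((hh (iota L))%:E =
        limn_esup (fun m : nat => ((m%:R `^ s)^-1 * h (L *+ m))%:E))%E,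
      forall (t : R) (M : V), 0 <= t -> hh (t *: M) = t `^ s * hh M
    & cont_fin_dim hh].
Proof.
have [hh [hhE hhZ]] := free_height_factors; exists hh; split=> // [L|n v].
  have -> : hh (iota L) = free_height (fdelta R L).
    have := hhE [:: (1, L)]; rewrite /fcombR !big_seq1 /=.
    by rewrite !scale1r.
  rewrite (@free_heightE _ _ _ _ [:: L])//; last first.
    by move=> y; rewrite inE /fdelta => /negPf ->.
  rewrite rlimsupE; last exact: scaled_height_bounded.
  congr limn_esup; apply/funext => m.
  (* For a delta function the rounding is exact: floor(m) = m. *)
  rewrite /scaled_height /fcomb big_seq1 /fdelta eqxx mulr1.
  by rewrite (floor_def (m := m%:Z)) ?pmulrn// lexx /= ltr_int; lia.
have [l lE] := choice (fun i => realification_span hV (v i)).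
pose D := undup (flatten [seq [seq x.2 | x <- l i] | i <- enum 'I_n]).
have D0 i y : y \notin D -> fcombR (l i) y = 0.
  rewrite mem_undup => yD; apply: fcombR_supp; apply: contra yD => yi.
  by apply/flatten_mapP; exists i; rewrite ?mem_enum.
have C := @free_height_combination_continuous n (fun i => fcombR (l i)) D (undup_uniq _) D0.
suff -> : (fun t : 'rV[R]_n => hh (\sum_(i < n) t ord0 i *: v i)) =
    (fun t : 'rV[R]_n => free_height (\sum_(i < n) t ord0 i *: fcombR (l i))) by [].
apply/funext => t.
(* A formal combination representing the sum of the t_i v_i; its coefficient function depends
   linearly on [t]. *)
pose lt := flatten [seq [seq (t ord0 i * x.1, x.2) | x <- l i] | i <- enum 'I_n].
have -> : \sum_(i < n) t ord0 i *: v i = \sum_(x <- lt) x.1 *: iota x.2.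
  rewrite big_flatten big_map big_enum /=; apply: eq_bigr => i _.
  rewrite lE big_map scaler_sumr; apply: eq_bigr => x _.
  by rewrite scalerA.
rewrite hhE /fcombR; congr free_height.
rewrite big_flatten big_map big_enum /=; apply: eq_bigr => i _.
rewrite big_map scaler_sumr; apply: eq_bigr => x _.
by rewrite scalerA.
Qed.

End Existence.

Theorem theoremA1 (R : realType) (P : zmodType) (V : lmodType R)
  (iota : {additive P -> V}) (hV : is_realification iota)
  (h : P -> R) (s : R) (hs : 0 < s) (hgrowth : height_growth h s) :
  exists! hh : V -> R,
    [/\ forall L : P,
          ((hh (iota L))%:E =
           limn_esup (fun m : nat => ((m%:R `^ s)^-1 * h (L *+ m))%:E))%E,
        forall (t : R) (M : V), 0 <= t -> hh (t *: M) = t `^ s * hh M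
      & cont_fin_dim hh].
Proof.
have [hh [hhi hhZ hhc]] := homogenization_exists hV hs hgrowth.
exists hh; split=> // hh' [hhi' hhZ' hhc']; apply/funext => v.
have [l ->] := realification_span hV v.
apply: homogeneous_continuous_eq hhZ hhZ' hhc hhc' l => L.
by apply: EFin_inj; rewrite hhi hhi'.
Qed.
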